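(* Let $1<p<\infty$, let $\psi\in W^{1,p}(\mathbb{R}^d)$, and let $X=\{x_j\}_{j\in\mathbb{Z}^d}$ be a countable discrete subset of $\mathbb{R}^d$. Suppose that $\{\tau_{x_j}\psi\}_{j\in\mathbb{Z}^d}$ is a $p$-Riesz basis of $V^p(\psi;X)$. Then for every $j\in\mathbb{Z}^d$ there exists $\delta_j>0$ such that, for every $Y=\{y_j\}_{j\in\mathbb{Z}^d}\subset\mathbb{R}^d$ with $|x_j-y_j|_2<\delta_j$ for all $j\in\mathbb{Z}^d$, the set $\{\tau_{y_j}\psi\}_{j\in\mathbb{Z}^d}$ is a $p$-Riesz basis of $V^p(\psi;Y)$.
   Context: $\tau_s f(x)=f(x+s)$ denotes translation; $|\cdot|_2$ is the Euclidean norm on $\mathbb{R}^d$; $\|\cdot\|_p$ is the norm of $L^p(\mathbb{R}^d)$. A countable set $X=\{x_j\}\subset\mathbb{R}^d$ is discrete if for every $x_j\in X$ there exists $\delta>0$ (depending on $j$) such that $|x_j-x_k|_2>\delta$ for every $k\neq j$. $W^{1,p}(\mathbb{R}^d)$ is the Sobolev space of $L^p(\mathbb{R}^d)$ functions whose first-order partial distributional derivatives are also in $L^p(\mathbb{R}^d)$. For $\psi\in L^p(\mathbb{R}^d)$ and $X=\{x_j\}_{j\in\mathbb{Z}^d}\subset\mathbb{R}^d$, $V^p(\psi;X)$ is the closure in $L^p(\mathbb{R}^d)$ of $\mathrm{Span}\{\tau_{x_j}\psi\}_{j\in\mathbb{Z}^d}$. The translates $\{\tau_{x_j}\psi\}_{j\in\mathbb{Z}^d}$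 form a $p$-Riesz basis of $V^p(\psi;X)$ if there exist constants $A,B>0$ such that for every finite set of coefficients $\vec d=\{d_j\}\subset\mathbb{C}$ (i.e. finitely many nonzero $d_j$, $j\in\mathbb{Z}^d$), $A\|\vec d\|_{\ell^p}\le\|\sum_j d_j\tau_{x_j}\psi\|_p\le B\|\vec d\|_{\ell^p}$, where $\|\vec d\|_{\ell^p}=(\sum_j|d_j|^p)^{1/p}$. *)

(* Defs.v *)
From HB Require Import structures.
From mathcomp Require Import all_boot all_order all_algebra.
From mathcomp Require Import finmap complex.
From mathcomp Require Import all_classical all_reals all_analysis.

Set Implicit Arguments.
Unset Strict Implicit.
Unset Printing Implicit Defensive.

Import Order.TTheory GRing.Theory Num.Theory.
Import numFieldNormedType.Exports.

Local Open Scope classical_set_scope.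
Local Open Scope ring_scope.

(* R^d is 'rV[R]_d. As the library does for pairs and tuples, it is given the
   product of d copies of the Borel sigma-algebra of R, which is the Borel
   sigma-algebra of R^d. *)
Section rV_measurable.
Context (R : realType) (d : nat).

Definition rV_coord (i : 'I_d) (v : 'rV[R]_d) : measurableTypeR R := v 0 i.

Let rV_set0 : g_sigma_preimage rV_coord set0.
Proof. exact: sigma_algebra0. Qed.

Let rV_setC A : g_sigma_preimage rV_coord A -> g_sigma_preimage rV_coord (~` A).
Proof. exact: sigma_algebraC. Qed.

Let rV_bigcup (F : _^nat) : (forall i, g_sigma_preimage rV_coord (F i)) ->
  g_sigma_preimage rV_coord (\bigcup_i (F i)).
Proof. exact: sigma_algebra_bigcup. Qed.

HB.instance Definition _ := @isMeasurable.Build default_measure_display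
  'rV[R]_d (g_sigma_preimage rV_coord) rV_set0 rV_setC rV_bigcup.

End rV_measurable.

Section lebesgue_rV.
Context (R : realType).

Definition rV_cons d (vx : 'rV[R]_d * measurableTypeR R) : 'rV[R]_d.+1 :=
  row_mx (vx.2 : R)%:M vx.1.

Lemma measurable_rV_coord d (i : 'I_d) : measurable_fun setT (@rV_coord R d i).
Proof.
move=> _ Y mY; rewrite setTI; apply: sub_sigma_algebra => /=.
rewrite -bigcup_seq/=; exists i => /=; first by rewrite mem_index_enum.
by exists Y => //; rewrite setTI.
Qed.

Lemma rV_coord_cons0 d (vx : 'rV[R]_d * measurableTypeR R) :
  rV_coord ord0 (rV_cons vx) = vx.2.
Proof.
have -> : (ord0 : 'I_d.+1) = lshift d (ord0 : 'I_1) by apply/val_inj.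
rewrite /rV_coord; transitivity ((vx.2 : R)%:M (0 : 'I_1) (0 : 'I_1)).
  exact: (row_mxEl (vx.2 : R)%:M vx.1 0 0).
by rewrite mxE eqxx mulr1n.
Qed.

Lemma rV_coord_consS d (vx : 'rV[R]_d * measurableTypeR R) i :
  rV_coord (lift ord0 i) (rV_cons vx) = rV_coord i vx.1.
Proof.
have -> : (lift ord0 i : 'I_d.+1) = rshift 1 i by apply/val_inj.
exact: (row_mxEr (vx.2 : R)%:M vx.1 0 i).
Qed.

Lemma measurable_rV_cons d : measurable_fun setT (@rV_cons d).
Proof.
pose G : set (set 'rV[R]_d.+1) :=
  \big[setU/set0]_(i < d.+1)
    preimage_set_system setT (@rV_coord R d.+1 i) measurable.
apply: (@measurability _ _ _ _ _ _ G) => // _ [B + <-].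
rewrite /G -bigcup_seq => - [i _ [Y mY <-]]; rewrite !setTI -comp_preimage -[X in measurable X]setTI.
have [j ->|->] := unliftP ord0 i.
- rewrite (_ : _ \o _ = rV_coord j \o fst); last first.
    by apply/funext => vx; exact: rV_coord_consS.
  exact: (measurableT_comp (measurable_rV_coord j) measurable_fst).
- rewrite (_ : _ \o _ = snd); first exact: measurable_snd.
  by apply/funext => vx; exact: rV_coord_cons0.
Qed.

Section step.
Context d (m : {measure set 'rV[R]_d -> \bar R}).
Local Open Scope ereal_scope.

Definition lebesgue_rV_step : set 'rV[R]_d.+1 -> \bar R :=
  pushforward (m \x @lebesgue_measure R) (@rV_cons d).

Let step0 : lebesgue_rV_step set0 = 0.
Proof. by rewrite /lebesgue_rV_step /pushforward preimage_set0 measure0. Qed.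

Let step_ge0 A : 0 <= lebesgue_rV_step A.
Proof. by rewrite /lebesgue_rV_step /pushforward; exact: measure_ge0. Qed.

Let step_sigma_additive : semi_sigma_additive lebesgue_rV_step.
Proof.
apply: (@measure_semi_sigma_additive _ _ _ _).
exact: measurable_rV_cons.
Qed.

HB.instance Definition _ := isMeasure.Build _ _ _ lebesgue_rV_step
  step0 step_ge0 step_sigma_additive.

End step.

(* Lebesgue measure on R^d, as an iterated product of the one-dimensional one;
   lebesgue_rV_box gives its values on boxes. *)
Fixpoint lebesgue_rV d : {measure set 'rV[R]_d -> \bar R} :=
  if d is d'.+1 then lebesgue_rV_step (lebesgue_rV d')
  else \d_(0 : 'rV[R]_0).

Lemma lebesgue_rV_box d (A : 'I_d -> set (measurableTypeR R)) :
  (forall i, measurable (A i)) ->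
  (lebesgue_rV d [set v | forall i, A i (rV_coord i v)] =
   \prod_(i < d) lebesgue_measure (A i))%E.
Proof.
elim: d A => [|d IHd] A mA /=.
  by rewrite big_ord0 diracE mem_set// => -[].
rewrite /lebesgue_rV_step /pushforward big_ord_recl muleC -IHd//.
rewrite -product_measure1E//; last first.
  rewrite [X in measurable X](_ : _ =
      \big[setI/setT]_(i < d) (@rV_coord R d i @^-1` A (lift ord0 i))).
    apply: bigsetI_measurable => i _; rewrite -[X in measurable X]setTI.
    exact: measurable_rV_coord.
  rewrite -bigcap_seq; apply/seteqP; split => [v Av i _|v Av i]; first exact: Av.
  by apply: Av; rewrite /= mem_index_enum.
congr (_ _); apply/seteqP; split => [vx Avx|vx [Av Ax] i].
- split; last by rewrite -rV_coord_cons0; exact: Avx.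
  by move=> i; rewrite -rV_coord_consS; exact: Avx.
- have [j ->|->] := unliftP ord0 i.
    by rewrite rV_coord_consS; exact: Av.
  by rewrite rV_coord_cons0.
Qed.

End lebesgue_rV.

Arguments lebesgue_rV R d : clear implicits.

Section function_spaces.
Context (R : realType) (d : nat).
Local Notation C := (complex R).
Local Notation mu := (lebesgue_rV R d).
Implicit Types (f g phi : 'rV[R]_d -> C) (p : R).

Definition translate (s : 'rV[R]_d) f : 'rV[R]_d -> C := fun x => f (x + s).

Definition Lp_norm p f : \bar R :=
  Lnorm mu p%:E (fun x => (Normc.normc (f x))%:E).

(* Elements of L^p are given by Borel representatives. *)
Definition in_Lp p f : Prop :=
  [/\ measurable_fun setT (fun x => complex.Re (f x)),
      measurable_fun setT (fun x => complex.Im (f x)) &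
      (Lp_norm p f < +oo)%E].

(* Complex-valued integrands: \int below is the real-valued integral. *)
Definition integralC f : C :=
  Complex (\int[mu]_x complex.Re (f x)) (\int[mu]_x complex.Im (f x)).

Definition partial (i : 'I_d) (u : 'rV[R]_d -> R) : 'rV[R]_d -> R :=
  fun x => 'D_(delta_mx 0 i) u x.

(* foldr partial u [:: i1; ...; in] is the iterated partial derivative
   d_i1 ... d_in u. *)
Definition smooth (u : 'rV[R]_d -> R) : Prop :=
  forall s : seq 'I_d, continuous (foldr partial u s) /\
    forall i x, derivable (foldr partial u s) x (delta_mx 0 i).

Definition test_function phi : Prop :=
  [/\ smooth (fun x => complex.Re (phi x)),
      smooth (fun x => complex.Im (phi x)) &
      compact (closure [set x | phi x != 0])].

Definition partialC (i : 'I_d) phi : 'rV[R]_d -> C := fun x =>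
  Complex (partial i (fun y => complex.Re (phi y)) x)
          (partial i (fun y => complex.Im (phi y)) x).

Definition is_weak_partial (i : 'I_d) f g : Prop :=
  forall phi, test_function phi ->
    integralC (fun x => f x * partialC i phi x) =
    - integralC (fun x => g x * phi x).

Definition in_W1p p f : Prop :=
  in_Lp p f /\ forall i : 'I_d, exists2 g, in_Lp p g & is_weak_partial i f g.

Definition enorm (v : 'rV[R]_d) : R := Num.sqrt (\sum_(i < d) v 0 i ^+ 2).

Section families.
Context (I : choiceType).
Implicit Types (F : I -> 'rV[R]_d -> C) (x : I -> 'rV[R]_d).

(* Indexed by j, so that x is in particular injective. *)
Definition discrete_family x : Prop :=
  forall j, exists2 e : R, 0 < e & forall k, k != j -> e < enorm (x j - x k).

Definition lin_comb F (c : {fsfun I -> C with 0}) : 'rV[R]_d -> C :=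
  fun t => \sum_(j <- finsupp c) c j * F j t.

Definition lp_norm p (c : {fsfun I -> C with 0}) : R :=
  (\sum_(j <- finsupp c) Normc.normc (c j) `^ p) `^ p^-1.

Definition closed_span p F : set ('rV[R]_d -> C) :=
  [set f | in_Lp p f /\ forall e : R, 0 < e ->
    exists c, (Lp_norm p (fun t => f t - lin_comb F c t)%R < e%:E)%E].

Definition Vp p f x := closed_span p (fun j => translate (x j) f).

(* A p-Riesz basis is only defined for the closed span V of the family, whence
   the first conjunct, which holds by definition for V = Vp p f x and
   F j = translate (x j) f. *)
Definition Riesz_basis p F (V : set ('rV[R]_d -> C)) : Prop :=
  V = closed_span p F /\
  exists A B : R, [/\ 0 < A, 0 < B & forall c : {fsfun I -> C with 0},
    ((A * lp_norm p c)%:E <= Lp_norm p (lin_comb F c))%E /\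
    (Lp_norm p (lin_comb F c) <= (B * lp_norm p c)%:E)%E].

End families.

End function_spaces.

(* Main.v *)
Require Import Defs.
From mathcomp Require Import all_boot all_order all_algebra.
From mathcomp Require Import finmap complex ring.
From mathcomp Require Import all_classical all_reals all_analysis.
From mathcomp Require Import measurable_realfun.
Import Order.TTheory GRing.Theory Num.Theory.
Import numFieldNormedType.Exports.
Local Open Scope classical_set_scope.
Local Open Scope ring_scope.

Set Implicit Arguments.
Unset Strict Implicit.
Unset Printing Implicit Defensive.

(** Why the theorem holds. Moving x j to y j changes the j-th generator by
    tau_(y j) psi - tau_(x j) psi, whose L^p norm equals that of
    tau_(x j - y j) psi - psi because Lebesgue measure is translation
    invariant, and is therefore as small as desired once delta j is small,
    because translation is continuous in L^p. Let A, B be the Riesz bounds of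
    the original family. Choose delta j so that the j-th change has norm at
    most eps j, where eps j > 0 and the sum of the eps j is at most A / 2 (the
    index set is countable). As |c j| <= ||c||_p for each j, the two
    combinations with coefficients c differ by at most (A / 2) ||c||_p, and
    A - A / 2 and B + A / 2 are Riesz bounds of the moved family
    ([Riesz_basis_perturbation]).

    The analytic input is [Lp_norm_translate_continuous]: for every f in L^p,
    ||tau_s f - f||_p tends to 0 with s. The functions with this property form
    a vector space that is closed under dominated pointwise limits
    ([Lp_shift_continuous_lim]), and it contains the continuous functions of
    compact support, by dominated convergence. Multiplication by the cutoffs
    [cutoff k], which are continuous, compactly supported and increase to 1,
    brings everything into this setting: a pi-lambda argument gives the
    property for \1_E * cutoff k with E measurable, linearity for a simple
    function times a cutoff, and another dominated limit for any nonnegative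
    function of L^p; real and complex functions follow by decomposition. *)

(** * Translation invariance of Lebesgue measure *)

(** The shifted measure is a measure with the same values on half-open
    intervals, and these values determine Lebesgue measure. *)
Lemma lebesgue_measure_shift (R : realType) (s : R)
    (A : set (measurableTypeR R)) :
  measurable A ->
  lebesgue_measure
    ((fun t : measurableTypeR R => (t + s : measurableTypeR R)) @^-1` A) =
  lebesgue_measure A.
Proof.
move=> mA; pose f := fun t : measurableTypeR R => (t + s : measurableTypeR R).
have mf : measurable_fun setT f by exact: measurable_funD.
(* The measure structure of a pushforward depends on the measurability of the
   map: nu takes that proof as an argument. *)
pose nu : {measure set (measurableTypeR R) -> \bar R} :=
  pushforward lebesgue_measure f.
have nuE : forall X, ocitv X -> lebesgue_measure X = nu mf X.
  move=> _ [[a b] _ <-] /=.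
  rewrite /nu /= /pushforward.
  have -> : f @^-1` `]a, b] = `]a - s, b - s]%classic.
    by apply/seteqP; split => t /=; rewrite !in_itv/= ltrBlDr lerBrDr.
  rewrite !lebesgue_measure_itv/= !lte_fin ltrD2r.
  by rewrite -!EFinD opprB addrA subrK.
exact/esym/(lebesgue_measure_unique nuE).
Qed.

Lemma ge0_integral_measure_preserving d0 (T : measurableType d0) (R : realType)
    (m : {measure set T -> \bar R}) (f : T -> T) (g : T -> \bar R) :
  measurable_fun setT f ->
  (forall A, measurable A -> m (f @^-1` A) = m A) ->
  measurable_fun setT g -> (forall x, 0 <= g x)%E ->
  (\int[m]_x g (f x) = \int[m]_x g x)%E.
Proof.
move=> mf fm mg g0.
have := @ge0_integral_pushforward _ _ _ _ R _ mf m setT g measurableT mg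
  (fun x _ => g0 x).
rewrite preimage_setT => <-.
by apply: eq_measure_integral => A mA _; rewrite -[RHS]fm.
Qed.

Section lebesgue_rV_shift.
Context (R : realType).

Lemma measurable_into_rV d0 (T : measurableType d0) d (f : T -> 'rV[R]_d) :
  (forall i, measurable_fun setT (rV_coord i \o f)) -> measurable_fun setT f.
Proof.
move=> mf.
pose G : set (set 'rV[R]_d) :=
  \big[setU/set0]_(i < d)
    preimage_set_system setT (@rV_coord R d i) measurable.
apply: (@measurability _ _ _ _ _ _ G) => // _ [B + <-].
rewrite /G -bigcup_seq => - [i _ [Y mY <-]].
by rewrite !setTI -comp_preimage -[X in measurable X]setTI; exact: mf.
Qed.

Lemma measurable_shift d (s : 'rV[R]_d) :
  measurable_fun setT (fun v : 'rV[R]_d => v + s).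
Proof.
apply: measurable_into_rV => i.
rewrite (_ : _ \o _ = fun v => (rV_coord i v : R) + s 0 i).
  by apply: measurable_funD => //; exact: (measurable_rV_coord i).
by apply/funext => v; rewrite /= /rV_coord mxE.
Qed.

(** By induction on d: the measure of A is the integral over v of the length of
    the section of A above v. The shift by s translates this section by the
    first coordinate s0 of s, which preserves its length, and v by the remaining
    coordinates s', which preserves the integral. *)
Lemma lebesgue_rV_shift d (s : 'rV[R]_d) (A : set 'rV[R]_d) :
  measurable A ->
  lebesgue_rV R d ((fun v : 'rV[R]_d => v + s) @^-1` A) = lebesgue_rV R d A.
Proof.
elim: d s A => [|d IH] s A mA.
  by congr (lebesgue_rV R 0 _); apply/seteqP; split => v /=;
    rewrite !thinmx0.
rewrite /= /lebesgue_rV_step /pushforward /product_measure1.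
pose s0 := rV_coord ord0 s : R.
pose s' := \row_j s 0 (lift ord0 j) : 'rV[R]_d.
have consD v (t : R) : rV_cons (v, t : measurableTypeR R) + s =
    rV_cons (v + s', t + s0 : measurableTypeR R).
  apply/rowP => i; rewrite mxE -![_ 0 i]/(rV_coord i _ : R).
  have [j ->|->] := unliftP ord0 i.
    by rewrite !rV_coord_consS /rV_coord /= !mxE.
  by rewrite !rV_coord_cons0.
pose B := rV_cons (d := d) @^-1` A.
have mB : measurable B.
  by rewrite -[X in measurable X]setTI; exact: measurable_rV_cons.
pose g v := lebesgue_measure (xsection B v).
have mg : measurable_fun setT g by exact: measurable_fun_xsection.
transitivity (\int[lebesgue_rV R d]_v (g \o (fun v : 'rV[R]_d => v + s')%R) v)%E.
  apply: eq_integral => v _.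
  rewrite /= /g -(@lebesgue_measure_shift R s0 (xsection B (v + s')));
    last exact: measurable_xsection.
  by congr (lebesgue_measure _); apply/seteqP; split => t /=;
    rewrite /xsection /= !inE /= /B /= -consD.
apply: (@ge0_integral_measure_preserving _ _ _ (lebesgue_rV R d)
  (fun v : 'rV[R]_d => v + s') g) => //.
- exact: measurable_shift.
- exact: IH.
Qed.

End lebesgue_rV_shift.

(** * The L^p norm of real functions *)

Section Lnorm_lemmas.
Context d0 (T : measurableType d0) (R : realType).
Context (m : {measure set T -> \bar R}) (p : R).
Hypothesis p0 : 0 < p.
Local Notation N f := (Lnorm m p%:E (fun x => (f x)%:E)).

Lemma measurable_powR_norm (f : T -> R) :
  measurable_fun setT f -> measurable_fun setT (fun x => (`|f x| `^ p)%:E).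
Proof.
move=> mf; apply/measurable_EFinP.
by apply: (measurableT_comp (measurable_powR p)); exact: measurableT_comp.
Qed.

Lemma LnormE (f : T -> R) : (N f = (\int[m]_x (`|f x| `^ p)%:E) `^ p^-1)%E.
Proof. by rewrite unlock. Qed.

Lemma Lnorm_powR (f : T -> R) : (N f `^ p = \int[m]_x (`|f x| `^ p)%:E)%E.
Proof. by rewrite poweR_Lnorm// gt_eqF. Qed.

Lemma le_Lnorm (f g : T -> R) : measurable_fun setT f -> measurable_fun setT g ->
  (forall x, `|f x| <= `|g x|) -> (N f <= N g)%E.
Proof.
move=> mf mg fg; rewrite !LnormE gt0_ler_poweR ?invr_ge0 ?(ltW p0)//.
- by rewrite in_itv/= leey andbT; apply: integral_ge0 => x _; rewrite lee_fin powR_ge0.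
- by rewrite in_itv/= leey andbT; apply: integral_ge0 => x _; rewrite lee_fin powR_ge0.
apply: ge0_le_integral => //.
- exact: measurable_powR_norm.
- exact: measurable_powR_norm.
- by move=> x _; rewrite lee_fin ge0_ler_powR ?nnegrE ?(ltW p0).
Qed.

Lemma Lnorm_scale (f : T -> R) (a : R) : measurable_fun setT f ->
  (N (fun x => a * f x)%R = `|a|%:E * N f)%E.
Proof.
move=> mf; rewrite !LnormE.
under eq_integral do rewrite normrM powRM// EFinM.
rewrite ge0_integralZl_EFin ?powR_ge0//; last exact: measurable_powR_norm.
rewrite poweRM ?lee_fin ?powR_ge0//; last first.
  by apply: integral_ge0 => x _; rewrite lee_fin powR_ge0.
by rewrite poweR_EFin -powRrM mulfV ?gt_eqF// powRr1.
Qed.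

Lemma Lnorm_lt (f : T -> R) (e : R) : 0 < e ->
  (\int[m]_x (`|f x| `^ p)%:E < (e `^ p)%:E)%E -> (N f < e%:E)%E.
Proof.
move=> e0; rewrite -Lnorm_powR; apply: contraTT; rewrite -!leNgt => eN.
rewrite -poweR_EFin gt0_ler_poweR ?(ltW p0)// in_itv/= leey andbT ?lee_fin ?(ltW e0)//.
exact: Lnorm_ge0.
Qed.

(** Dominated convergence for the integrals of |h n| ^ p, whose dominating
    function is |G| ^ p. The conclusion is in epsilon form because it is applied
    to pick one index n. *)
Lemma Lnorm_dominated_cvg0 (h : nat -> T -> R) (G : T -> R) :
  (forall n, measurable_fun setT (h n)) -> measurable_fun setT G ->
  (N G < +oo)%E -> (forall n x, `|h n x| <= `|G x|) ->
  (forall x, h n x @[n --> \oo] --> 0) ->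
  forall e, 0 < e -> \forall n \near \oo, (N (h n) < e%:E)%E.
Proof.
move=> mh mG Gfin hG h0 e e0.
have := @dominated_convergence _ _ _ m setT measurableT
  (fun n x => (`|h n x| `^ p)%:E) (cst 0) (fun x => (`|G x| `^ p)%:E)
  (fun n => measurable_powR_norm (mh n)) (@measurable_cst _ _ _ _ _ _).
case.
- apply: aeW => x _ /=; apply: cvg_EFin; first by near=> n.
  apply/cvgr0Pnorm_lt => eps eps0.
  have := h0 x; move/cvgr0Pnorm_lt => /(_ (eps `^ p^-1)).
  rewrite powR_gt0// => /(_ isT); apply: filterS => n hn /=.
  rewrite ger0_norm ?powR_ge0//.
  rewrite (lt_le_trans (gt0_ltr_powR _ _ _ hn))// ?nnegrE ?powR_ge0//.
  by rewrite -powRrM mulVf ?gt_eqF// powRr1// ltW.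
- apply/integrableP; split; first exact: measurable_powR_norm.
  under eq_integral do rewrite gee0_abs ?lee_fin ?powR_ge0//.
  by rewrite -Lnorm_powR poweR_lty.
- apply: aeW => x n _ /=.
  by rewrite lee_fin ger0_norm ?powR_ge0// ge0_ler_powR ?nnegrE ?(ltW p0).
move=> _ _; rewrite integral0 => /(_ [set y | (y < (e `^ p)%:E)%E]).
have /[swap]/[apply] : nbhs (0 : \bar R)%E [set y | (y < (e `^ p)%:E)%E].
  apply: open_nbhs_nbhs; split; first exact: open_ereal_lt_ereal.
  by rewrite /= lte_fin powR_gt0.
move=> H; near=> n; apply: Lnorm_lt => //; near: n; exact: H.
Unshelve. all: by end_near. Qed.

Lemma Lnorm_measure_preserving (f : T -> T) (g : T -> R) :
  measurable_fun setT f ->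
  (forall A, measurable A -> m (f @^-1` A) = m A) ->
  measurable_fun setT g -> N (g \o f) = N g.
Proof.
move=> mf fm mg; rewrite !LnormE; congr (_ `^ _)%E.
apply: (@ge0_integral_measure_preserving _ _ _ m f (fun x => (`|g x| `^ p)%:E)) => //.
exact: measurable_powR_norm.
Qed.

End Lnorm_lemmas.

(** * Functions whose translates are continuous in L^p *)

Section translation_continuity.
Context (R : realType) (d : nat) (p : R).
Hypothesis p1 : 1 <= p.
Let p0 : 0 < p. Proof. exact: lt_le_trans p1. Qed.
Local Notation N f := (Lnorm (lebesgue_rV R d) p%:E (fun x => (f x)%:E)).
Implicit Types f g h : 'rV[R]_d -> R.

Definition Lp_shift_continuous f := forall e : R, 0 < e ->
  \forall s \near (0 : 'rV[R]_d), (N (fun x : 'rV[R]_d => f (x + s) - f x)%R < e%:E)%E.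

Lemma measurable_fun_shift f (s : 'rV[R]_d) : measurable_fun setT f ->
  measurable_fun setT (fun x : 'rV[R]_d => f (x + s)).
Proof. by move=> mf; apply: measurableT_comp mf (measurable_shift s). Qed.

Lemma Lnorm_shift f (s : 'rV[R]_d) : measurable_fun setT f ->
  N (fun x : 'rV[R]_d => f (x + s)) = N f.
Proof.
move=> mf.
apply: (@Lnorm_measure_preserving _ _ _ (lebesgue_rV R d) p
  (fun x : 'rV[R]_d => x + s) f) => //.
  exact: measurable_shift.
exact: lebesgue_rV_shift.
Qed.

(** Minkowski's inequality in a form that also applies when |f| is only bounded
    by |g| + |h|, as happens for moduli of complex functions. *)
Lemma Lnorm_triangle f g h : measurable_fun setT g -> measurable_fun setT h ->
  measurable_fun setT f ->
  (forall x, `|f x| <= `|g x| + `|h x|) -> (N f <= N g + N h)%E.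
Proof.
move=> mg mh mf fgh.
have abs1 (u : 'rV[R]_d -> R) : measurable_fun setT u ->
    (N u = N (fun x => `|u x|)%R)%E.
  by move=> mu; apply/eqP; rewrite eq_le !le_Lnorm//;
    solve [exact: measurableT_comp | by move=> x; rewrite normr_id].
have mg' : measurable_fun setT (fun x => `|g x|) by exact: measurableT_comp.
have mh' : measurable_fun setT (fun x => `|h x|) by exact: measurableT_comp.
rewrite (abs1 g)// (abs1 h)//; apply: le_trans (minkowski_EFin _ mg' mh' p1).
apply: le_Lnorm => //; first exact: measurable_funD.
by move=> x /=; rewrite (ger0_norm (addr_ge0 _ _)).
Qed.

Lemma Lp_shift_continuousD f g : measurable_fun setT f -> measurable_fun setT g ->
  Lp_shift_continuous f -> Lp_shift_continuous g ->
  Lp_shift_continuous (fun x => f x + g x).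
Proof.
move=> mf mg cf cg e e0.
have e20 : 0 < e / 2 by rewrite divr_gt0.
near=> s.
have mfs := measurable_funB (measurable_fun_shift s mf) mf.
have mgs := measurable_funB (measurable_fun_shift s mg) mg.
apply: le_lt_trans (Lnorm_triangle mfs mgs _ _) _.
- apply: measurable_funB; last exact: measurable_funD.
  by apply: measurable_funD; exact: measurable_fun_shift.
- move=> x; apply: le_trans (ler_normD _ _).
  by rewrite le_eqVlt; apply/orP; left; apply/eqP; congr `|_|; rewrite /=; ring.
rewrite [e]splitr EFinD; apply: lteD; [near: s; exact: cf|near: s; exact: cg].
Unshelve. all: by end_near. Qed.

Lemma Lp_shift_continuousZ f a : measurable_fun setT f ->
  Lp_shift_continuous f -> Lp_shift_continuous (fun x => a * f x).
Proof.
move=> mf cf e e0.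
(* The + 1 keeps the denominator positive when a = 0. *)
have e20 : 0 < e / (`|a| + 1) by rewrite divr_gt0// ltr_wpDl.
near=> s.
have mfs := measurable_funB (measurable_fun_shift s mf) mf.
have -> : N (fun x : 'rV[R]_d => a * f (x + s) - a * f x) =
    (`|a|%:E * N (fun x : 'rV[R]_d => f (x + s) - f x)%R)%E.
  by rewrite -Lnorm_scale//; apply: eq_Lnorm => x; rewrite mulrBr.
have : (N (fun x : 'rV[R]_d => f (x + s) - f x)%R < (e / (`|a| + 1))%:E)%E.
  by near: s; exact: cf.
move=> lte; apply: le_lt_trans (lee_wpmul2l _ (ltW lte)) _ => //.
by rewrite -EFinM lte_fin mulrCA gtr_pMr// ltr_pdivrMr ?mul1r ?ltr_pwDr// ltr_wpDl.
Unshelve. all: by end_near. Qed.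

Lemma Lp_shift_continuous_sum (I : Type) (r : seq I) (F : I -> 'rV[R]_d -> R) :
  (forall i, measurable_fun setT (F i)) -> (forall i, Lp_shift_continuous (F i)) ->
  Lp_shift_continuous (fun x => \sum_(i <- r) F i x).
Proof.
move=> mF cF; elim: r => [|i r IH].
  move=> e e0; near=> s.
  rewrite (eq_Lnorm _ _ (g := cst 0%E)) => [|x]; last by rewrite !big_nil subrr.
  by rewrite Lnorm0 ?lte_fin// eqe gt_eqF.
under [X in Lp_shift_continuous X]eq_fun do rewrite big_cons.
by apply: Lp_shift_continuousD => //; exact: measurable_sum.
Unshelve. all: by end_near. Qed.

(** A three epsilon argument: by dominated convergence some g n is close to f in
    norm, by translation invariance the translate of g n is equally close to
    that of f, and g n is close to its small translates. *)
Lemma Lp_shift_continuous_lim (g : nat -> 'rV[R]_d -> R) f G :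
  (forall n, measurable_fun setT (g n)) -> measurable_fun setT f ->
  measurable_fun setT G -> (N G < +oo)%E ->
  (forall n x, `|g n x| <= `|G x|) -> (forall x, `|f x| <= `|G x|) ->
  (forall x, g n x @[n --> \oo] --> f x) ->
  (forall n, Lp_shift_continuous (g n)) -> Lp_shift_continuous f.
Proof.
move=> mg mf mG Gfin gG fG gf cg e e0.
have e30 : 0 < e / 3 by rewrite divr_gt0.
have [n Nn] : exists n, (N (fun x => g n x - f x)%R < (e / 3)%:E)%E.
  have mgf n : measurable_fun setT (fun x => g n x - f x) by exact: measurable_funB.
  have mG2 : measurable_fun setT (fun x => 2 * G x) by exact: measurable_funM.
  have [||| n _ /(_ n (leqnn n)) Hn] :=
    @Lnorm_dominated_cvg0 _ _ _ (lebesgue_rV R d) p p0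
      (fun n x => g n x - f x) (fun x => 2 * G x) mgf mG2 _ _ _ _ e30.
  - by rewrite Lnorm_scale// lte_mul_pinfty.
  - move=> n x; rewrite normrM ger0_norm// mulr_natl mulr2n.
    by apply: le_trans (ler_normB _ _) _; rewrite lerD.
  - move=> x; rewrite -[X in _ --> X](subrr (f x)); apply: cvgB => //.
    exact: cvg_cst.
  - by exists n.
near=> s.
have mgs := measurable_funB (measurable_fun_shift s (mg n)) (mg n).
have mgf := measurable_funB (mg n) mf.
have mgfs : measurable_fun setT (fun x : 'rV[R]_d => g n (x + s) - f (x + s)).
  exact: (measurable_fun_shift s mgf).
have mfs := measurable_funB (measurable_fun_shift s mf) mf.
have mA : measurable_fun setT
    (fun x : 'rV[R]_d => (g n (x + s) - g n x) + (g n x - f x)).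
  exact: measurable_funD.
apply: (@le_lt_trans _ _ (N (fun x : 'rV[R]_d => g n (x + s) - g n x)%R +
    N (fun x : 'rV[R]_d => g n x - f x)%R +
    N (fun x : 'rV[R]_d => g n (x + s) - f (x + s))%R)%E).
  apply: le_trans (leeD2r _ (Lnorm_triangle mgs mgf mA _)).
  - apply: Lnorm_triangle => // x; apply: le_trans (ler_normB _ _).
    by rewrite le_eqVlt; apply/orP; left; apply/eqP; congr `|_|; rewrite /=; ring.
  - by move=> x; exact: ler_normD.
rewrite (Lnorm_shift s mgf).
have -> : e = e / 3 + e / 3 + e / 3 by field.
rewrite 2!EFinD !lteD//; by near: s; exact: cg.
Unshelve. all: by end_near. Qed.

End translation_continuity.

(** * Continuous cutoff functions *)

Section clamp.
Context (R : realType).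

Definition clamp (t : R) : R := Num.max 0 (Num.min 1 t).

Lemma clamp_ge0 t : 0 <= clamp t. Proof. by rewrite /clamp le_max lexx. Qed.

Lemma clamp_le1 t : clamp t <= 1.
Proof. by rewrite /clamp ge_max ler01 ge_min lexx. Qed.

Lemma clamp_ge1 t : 1 <= t -> clamp t = 1.
Proof. by move=> t1; rewrite /clamp min_l// max_r. Qed.

Lemma clamp_le0 t : t <= 0 -> clamp t = 0.
Proof. by move=> t0; rewrite /clamp min_r ?max_l// (le_trans t0). Qed.

Lemma continuous_clamp : continuous clamp.
Proof.
move=> t; apply: (@continuous_max R R (cst 0) (fun t => Num.min 1 t)).
  exact: cvg_cst.
apply: (@continuous_min R R (cst 1) id); first exact: cvg_cst.
exact: cvg_id.
Qed.

Lemma measurable_clamp : measurable_fun setT clamp.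
Proof. exact: continuous_measurable_fun continuous_clamp. Qed.

End clamp.

Section cutoff.
Context (R : realType) (d : nat) (p : R).
Hypothesis p1 : 1 <= p.
Let p0 : 0 < p. Proof. exact: lt_le_trans p1. Qed.
Local Notation N f := (Lnorm (lebesgue_rV R d) p%:E (fun x => (f x)%:E)).
Implicit Types f g h : 'rV[R]_d -> R.

Definition cube (K : R) : set 'rV[R]_d := [set x | forall i, `|x 0 i| <= K].

Lemma cubeE K : cube K = [set x | forall i, `[- K, K]%classic (rV_coord i x)].
Proof.
by apply/seteqP; split => x xK i; move: (xK i); rewrite /= in_itv/= ler_norml.
Qed.

Lemma measurable_cube K : measurable (cube K).
Proof.
rewrite cubeE [X in measurable X](_ : _ =
    \big[setI/setT]_(i < d) (@rV_coord R d i @^-1` `[- K, K]%classic)).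
  apply: bigsetI_measurable => i _; rewrite -[X in measurable X]setTI.
  by apply: measurable_rV_coord => //; exact: measurable_itv.
rewrite -bigcap_seq; apply/seteqP; split => [v Av i _|v Av i]; first exact: Av.
by apply: Av; rewrite /= mem_index_enum.
Qed.

Lemma lebesgue_cube_lty K : (lebesgue_rV R d (cube K) < +oo)%E.
Proof.
rewrite cubeE (lebesgue_rV_box (A := fun=> `[- K, K]%classic)); last first.
  by move=> i; exact: measurable_itv.
set L := (X in (X < _)%E); suff [] : (0 <= L /\ L < +oo)%E by [].
rewrite /L.
apply: (big_ind (fun z => 0 <= z /\ z < +oo)%E) => [|x y [x0 xy] [y0 yy]|i _].
  by rewrite ltry.
  by split; [exact: mule_ge0|rewrite lte_mul_pinfty// ge0_fin_numE].
split; first exact: measure_ge0.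
by rewrite lebesgue_measure_itv/=; case: ifPn => // _; rewrite -EFinB ltry.
Qed.

Lemma Lnorm_cube_lty K a : (N (fun x => a * \1_(cube K) x)%R < +oo)%E.
Proof.
rewrite Lnorm_scale//; last exact: measurable_indic (measurable_cube K).
rewrite lte_mul_pinfty// LnormE poweR_lty//.
under eq_integral => x _.
  rewrite (_ : (`|\1_(cube K) x| `^ p) = \1_(cube K) x); last first.
    by rewrite indicE; case: (_ \in _); rewrite ?normr1 ?normr0 ?powR1 ?powR0 ?gt_eqF.
  over.
by rewrite integral_indic ?setIT ?lebesgue_cube_lty//; exact: measurable_cube.
Qed.

(** If not, there are shifts s n tending to 0 for which the norm stays at least
    e; but h (x + s n) - h x tends to 0 pointwise, is bounded by 2, and vanishes
    outside a cube, so dominated convergence applies. *)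
Lemma Lp_shift_continuous_compact h K :
  continuous h -> measurable_fun setT h ->
  (forall x, `|h x| <= 1) -> (forall x, ~ cube K x -> h x = 0) ->
  Lp_shift_continuous p h.
Proof.
move=> ch mh h1 hK e e0.
apply: contrapT => /nbhs_ballP nP.
have /choice[s sP] : forall n : nat, exists s : 'rV[R]_d,
    ball (0 : 'rV[R]_d) n.+1%:R^-1 s /\
    ~ (N (fun x : 'rV[R]_d => h (x + s) - h x)%R < e%:E)%E.
  move=> n; apply: contrapT => nex; apply: nP; exists n.+1%:R^-1 => //= s bs.
  by apply: contrapT => Ns; apply: nex; exists s.
have s0 : s n @[n --> \oo] --> (0 : 'rV[R]_d).
  apply/cvg_ballP => eps eps0; near=> n.
  apply: (@le_ball _ _ _ n.+1%:R^-1); last exact: (sP n).1.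
  by apply: ltW; near: n; exact: near_infty_natSinv_lt (PosNum eps0).
have mhs n : measurable_fun setT (fun x : 'rV[R]_d => h (x + s n) - h x).
  exact: measurable_funB (measurable_fun_shift (s n) mh) mh.
(* K + 1: the shifts s n have coordinates at most 1. *)
have mG : measurable_fun setT (fun x => 2 * \1_(cube (K + 1)) x : R).
  by apply: measurable_funM => //; exact: measurable_indic (measurable_cube _).
have [||| n _ /(_ n (leqnn n))] :=
  @Lnorm_dominated_cvg0 _ _ _ (lebesgue_rV R d) p p0
    (fun n x => h (x + s n) - h x) (fun x => 2 * \1_(cube (K + 1)) x)
    mhs mG _ _ _ _ e0.
- exact: Lnorm_cube_lty.
- move=> n x; rewrite indicE; have [xK|] := boolP (x \in _).
    rewrite mulr1 (@ger0_norm _ 2)// (le_trans (ler_normB _ _))//.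
    by rewrite (_ : 2 = 1 + 1)// lerD.
  rewrite notin_setE => xK; rewrite !hK ?subrr ?normr0//;
    first by move=> xK'; apply: xK => i; rewrite (le_trans (xK' i))// lerDl.
  move=> xK'; apply: xK => i.
  have -> : x 0 i = (x + s n) 0 i - s n 0 i by rewrite mxE addrK.
  rewrite (le_trans (ler_normB _ _))// lerD//.
  have [_ /(_ 0 i)] := (sP n).1.
  rewrite -ball_normE /ball_ /= !mxE sub0r normrN => /ltW/le_trans; apply.
  by rewrite invf_le1// ler1n.
- move=> x; rewrite -[X in _ --> X](subrr (h x)); apply: cvgB; last exact: cvg_cst.
  apply: (cvg_comp (fun n => x + s n) h); last exact: ch.
  have : x + s n @[n --> \oo] --> x + 0 by apply: cvgD => //; exact: cvg_cst.
  by rewrite addr0.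
- exact: (sP n).2.
Unshelve. all: by end_near. Qed.

(** The value is 1 where the l^1 norm of x is at most k, and 0 where it is at
    least k + 1. *)
Definition cutoff (k : nat) (x : 'rV[R]_d) : R :=
  clamp (k%:R + 1 - \sum_(i < d) `|x 0 i|).

Lemma cutoff_norm_le1 k x : `|cutoff k x| <= 1.
Proof. by rewrite ger0_norm ?clamp_ge0 ?clamp_le1. Qed.

Lemma continuous_coord i : continuous (fun x : 'rV[R]_d => x 0 i).
Proof. exact: coord_continuous. Qed.

Lemma measurable_coord i : measurable_fun setT (fun x : 'rV[R]_d => x 0 i).
Proof. exact: measurable_rV_coord. Qed.

Lemma continuous_cutoff k : continuous (cutoff k).
Proof.
move=> x.
have sum_cont (r : seq 'I_d) :
    continuous (fun y : 'rV[R]_d => \sum_(i <- r) `|y 0 i|).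
  elim: r => [|i r IH] y.
    by under eq_fun do rewrite big_nil; exact: cst_continuous.
  under eq_fun do rewrite big_cons.
  exact: cvgD (cvg_norm (@continuous_coord i y)) (IH y).
have arg_cont : {for x, continuous (fun y : 'rV[R]_d => k%:R + 1 - \sum_i `|y 0 i|)}.
  exact: (@cvgB _ _ _ (nbhs x) _ _ _ _ _ (cvg_cst _) (sum_cont _ x)).
exact: (continuous_comp arg_cont (@continuous_clamp R _)).
Qed.

Lemma measurable_cutoff k : measurable_fun setT (cutoff k).
Proof.
apply: measurableT_comp (@measurable_clamp R) _.
apply: measurable_funB => //; apply: measurable_sum => i.
by apply: measurableT_comp => //; exact: measurable_coord.
Qed.

Lemma cutoff_eq0 k x : ~ cube (k%:R + 1) x -> cutoff k x = 0.
Proof.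
move=> xk; apply: clamp_le0; rewrite subr_le0 leNgt; apply/negP => slt; apply: xk => i.
apply: le_trans (ltW slt); rewrite (bigD1 i)//= lerDl.
by apply: sumr_ge0.
Qed.

Lemma cvg_cutoff x : cutoff k x @[k --> \oo] --> (1 : R).
Proof.
apply: cvg_near_cst; near=> k; apply: clamp_ge1.
rewrite lerBrDl lerD2r; near: k; exact: nbhs_infty_ger.
Unshelve. all: by end_near. Qed.

Lemma Lnorm_cutoff_lty k : (N (cutoff k) < +oo)%E.
Proof.
apply: le_lt_trans (Lnorm_cube_lty (k%:R + 1) 1).
apply: le_Lnorm => //; first exact: measurable_cutoff.
  by apply: measurable_funM => //; exact: measurable_indic (measurable_cube _).
move=> x; rewrite mul1r indicE; have [_|] := boolP (x \in _).
  by rewrite normr1 cutoff_norm_le1.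
by rewrite notin_setE => /cutoff_eq0 ->.
Qed.

Lemma Lp_shift_continuous_mul_cutoff h k :
  continuous h -> measurable_fun setT h -> (forall x, `|h x| <= 1) ->
  Lp_shift_continuous p (fun x => h x * cutoff k x).
Proof.
move=> ch mh h1; apply: (@Lp_shift_continuous_compact _ (k%:R + 1)).
- by move=> x; exact: cvgM (ch x) (@continuous_cutoff k x).
- by apply: measurable_funM => //; exact: measurable_cutoff.
- by move=> x; rewrite normrM mulr_ile1// cutoff_norm_le1.
- by move=> x /cutoff_eq0 ->; rewrite mulr0.
Qed.

End cutoff.

(** * From continuous functions to measurable sets *)

Section pi_lambda.
Context (R : realType) (d : nat).

(** These sets form a pi-system (multiply the approximating functions) that
    contains the coordinate half-spaces, hence generates the Borel sets. Asking
    for continuous approximations, rather than for boxes, makes the generating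
    sets satisfy the property to be proved by a single dominated limit. *)
Definition continuous_limit_set (E : set 'rV[R]_d) : Prop :=
  measurable E /\ exists phi : nat -> 'rV[R]_d -> R,
    [/\ forall n, continuous (phi n), forall n, measurable_fun setT (phi n),
        forall n x, `|phi n x| <= 1 & forall x, phi n x @[n --> \oo] --> (\1_E x : R)].

Lemma continuous_limit_setI : setI_closed continuous_limit_set.
Proof.
move=> A B [mA [f [cf mf f1 fA]]] [mB [g [cg mg g1 gB]]].
split; first exact: measurableI.
exists (fun n x => f n x * g n x); split => [n x|n|n x|x].
- exact: cvgM (cf n x) (cg n x).
- exact: measurable_funM.
- by rewrite normrM mulr_ile1.
- by rewrite indicI; exact: cvgM (fA x) (gB x).
Qed.

Lemma continuous_limit_set_halfspace i (c : R) :
  continuous_limit_set (@rV_coord R d i @^-1` `]-oo, c[%classic).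
Proof.
split.
  rewrite -[X in measurable X]setTI; exact: measurable_rV_coord.
(* The slope n makes the ramp reach 1 at distance 1 / n inside the half-space,
   and it is 0 on the boundary, which lies outside. *)
exists (fun n x => clamp (n%:R * (c - x 0 i))); split => [n x|n|n x|x].
- have arg_cont : {for x, continuous (fun y : 'rV[R]_d => n%:R * (c - y 0 i))}.
    apply: (@cvgM _ _ (nbhs x) _ _ _ _ _ (cvg_cst _)).
    exact: (@cvgB _ _ _ (nbhs x) _ _ _ _ _ (cvg_cst _) (@continuous_coord R d i x)).
  exact: (continuous_comp arg_cont (@continuous_clamp R _)).
- apply: measurableT_comp (@measurable_clamp R) _.
  apply: measurable_funM => //; apply: measurable_funB => //.
  exact: measurable_coord.
- by rewrite ger0_norm ?clamp_ge0 ?clamp_le1.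
- apply: cvg_near_cst; rewrite indicE; have [|] := boolP (x \in _).
    rewrite inE /= in_itv/= => xc; near=> n; apply: clamp_ge1.
    rewrite -ler_pdivrMr ?subr_gt0//; near: n; exact: nbhs_infty_ger.
  rewrite notin_setE /= in_itv/= => /negP; rewrite -leNgt => cx; near=> n.
  by apply: clamp_le0; rewrite mulr_ge0_le0// subr_le0.
Unshelve. all: by end_near. Qed.

Lemma measurable_rV_continuous_limit (A : set 'rV[R]_d) :
  measurable A -> <<s continuous_limit_set >> A.
Proof.
apply: smallest_sub; first exact: smallest_sigma_algebra.
move=> B; rewrite -bigcup_seq => - [i _ [Y mY <-]].
(* It is enough that the i-th coordinate is measurable for the sigma-algebra
   generated by the sets in question. *)
pose f : g_sigma_algebraType continuous_limit_set -> measurableTypeR R :=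
  fun v => rV_coord i v.
suff mf : measurable_fun setT f by exact: mf.
apply: (@measurability _ _ _ _ _ _ (@RGenInftyO.G R)).
  exact: RGenInftyO.measurableE.
move=> _ [_ [c ->] <-].
rewrite setTI; apply: sub_sigma_algebra; exact: continuous_limit_set_halfspace.
Qed.

End pi_lambda.

(** * Continuity of translation in L^p *)

Section Lp_translation.
Context (R : realType) (d : nat) (p : R).
Hypothesis p1 : 1 <= p.
Let p0 : 0 < p. Proof. exact: lt_le_trans p1. Qed.
Local Notation N f := (Lnorm (lebesgue_rV R d) p%:E (fun x => (f x)%:E)).
Local Notation cutoff := (@cutoff R d).
Implicit Types f g h : 'rV[R]_d -> R.

Let mcutoff k : measurable_fun setT (cutoff k).
Proof. exact: measurable_cutoff. Qed.

Let mindic (E : set 'rV[R]_d) k : measurable E ->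
  measurable_fun setT (fun x => \1_E x * cutoff k x : R).
Proof. by move=> mE; apply: measurable_funM => //; exact: measurable_indic. Qed.

Let indic_cutoff_le (E : set 'rV[R]_d) k x : `|\1_E x * cutoff k x| <= `|cutoff k x|.
Proof.
by rewrite normrM ler_piMl// indicE; case: (_ \in _); rewrite ?normr1 ?normr0.
Qed.

(** The pi-lambda theorem. The cutoff is there to have \1_E * cutoff k dominated
    by one function of finite norm for all E, so that the class of good sets is
    closed under increasing unions and contains the whole space. *)
Lemma Lp_shift_continuous_indic (E : set 'rV[R]_d) k : measurable E ->
  Lp_shift_continuous p (fun x => \1_E x * cutoff k x).
Proof.
pose D : set (set 'rV[R]_d) := [set E | measurable E /\
  forall k, Lp_shift_continuous p (fun x => \1_E x * cutoff k x)].
move=> mE; suff [_ /(_ k)] : D E by [].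
have sub : <<s @continuous_limit_set R d >> `<=` D; last first.
  exact: (sub _ (measurable_rV_continuous_limit mE)).
apply: lambda_system_subset => //; first exact: continuous_limit_setI.
- split => //.
  + split => // k'; rewrite indicT.
    apply: Lp_shift_continuous_mul_cutoff => // [x|x]; first exact: cst_continuous.
    by rewrite normr1.
  + move=> A B BA [mA cA] [mB cB]; split => [|k']; first exact: measurableD.
    rewrite (_ : (fun x => _) =
      (fun x => \1_A x * cutoff k' x + (-1) * (\1_B x * cutoff k' x))); last first.
      apply/funext => x; rewrite mulN1r -mulrBl; congr (_ * _).
      rewrite !indicE in_setD.
      have [xB|] := boolP (x \in B); last by rewrite andbT subr0.
      by rewrite (mem_set (BA _ (set_mem xB))) subrr.
    apply: Lp_shift_continuousD => //; first exact: mindic.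
      by apply: measurable_funM => //; exact: mindic.
    by apply: Lp_shift_continuousZ => //; exact: mindic.
  + move=> F ndF DF; have mF : measurable (\bigcup_i F i).
      by apply: bigcup_measurable => i _; exact: (DF i).1.
    split => // k'.
    apply: (@Lp_shift_continuous_lim _ _ _ p1
      (fun n x => \1_(F n) x * cutoff k' x) _ (cutoff k')) => //.
    * by move=> n; apply: mindic; exact: (DF n).1.
    * exact: mindic.
    * exact: Lnorm_cutoff_lty.
    * move=> x; apply: cvgMl.
      apply: cvg_near_cst; rewrite !indicE; have [|] := boolP (x \in \bigcup_i F i).
        rewrite inE => -[i _ Fix]; exists i => // j /= ij.
        by rewrite indicE mem_set//; move/subsetPset: (ndF _ _ ij); apply.
      rewrite notin_setE => nF; near=> n.
      by rewrite indicE memNset// => Fn; apply: nF; exists n.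
    * by move=> n; exact: (DF n).2.
- move=> A [mA [phi [cphi mphi phi1 phiA]]]; split => // k'.
  apply: (@Lp_shift_continuous_lim _ _ _ p1
    (fun n x => phi n x * cutoff k' x) _ (cutoff k')) => //.
  + by move=> n; exact: measurable_funM.
  + exact: mindic.
  + exact: Lnorm_cutoff_lty.
  + by move=> n x; rewrite normrM ler_piMl.
  + by move=> x; apply: cvgMl.
  + by move=> n; exact: Lp_shift_continuous_mul_cutoff.
Unshelve. all: by end_near. Qed.

Import HBNNSimple.

Lemma Lp_shift_continuous_nnsfun (g : {nnsfun 'rV[R]_d >-> R}) k :
  Lp_shift_continuous p (fun x => g x * cutoff k x).
Proof.
have mg y : measurable (g @^-1` [set y]) by exact: measurable_sfunP.
rewrite (_ : (fun x => _) = (fun x => \sum_(y <- fset_set (range g))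
    y * (\1_(g @^-1` [set y]) x * cutoff k x))); last first.
  apply/funext => x; rewrite fimfunE fsbig_finite//= mulr_suml.
  by apply: eq_bigr => y _; rewrite mulrA.
apply: Lp_shift_continuous_sum => // y.
  by apply: measurable_funM => //; exact: mindic.
by apply: Lp_shift_continuousZ => //; [exact: mindic|exact: Lp_shift_continuous_indic].
Qed.

(** The products of the simple functions increasing to f with the cutoffs
    converge to f and are dominated by f itself. *)
Lemma Lp_shift_continuous_ge0 f : measurable_fun setT f -> (forall x, 0 <= f x) ->
  (N f < +oo)%E -> Lp_shift_continuous p f.
Proof.
move=> mf f0 Nf.
have mf' : measurable_fun setT (EFin \o f) by exact/measurable_EFinP.
pose g := nnsfun_approx measurableT mf'.
have gle n x : 0 <= g n x <= f x.
  rewrite fun_ge0 /= -lee_fin /g nnsfun_approxE.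
  by apply: (@le_approx _ _ _ setT (EFin \o f)) => // y _; rewrite lee_fin.
apply: (@Lp_shift_continuous_lim _ _ _ p1 (fun n x => g n x * cutoff n x) _ f) => //.
- by move=> n; exact: measurable_funM.
- move=> n x; have /andP[g0 gf] := gle n x.
  rewrite normrM (ger0_norm g0) (ger0_norm (f0 x)).
  by apply: le_trans gf; rewrite ler_piMr// cutoff_norm_le1.
- move=> x; rewrite -[X in _ --> X]mulr1; apply: cvgM; last exact: cvg_cutoff.
  have := @cvg_nnsfun_approx _ _ _ setT measurableT (EFin \o f) mf'
    (fun y _ => f0 y) x I.
  by move/fine_cvg.
- by move=> n; exact: Lp_shift_continuous_nnsfun.
Qed.

Theorem Lp_shift_continuous_measurable f : measurable_fun setT f ->
  (N f < +oo)%E -> Lp_shift_continuous p f.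
Proof.
move=> mf Nf.
have mfp : measurable_fun setT f^\+ by exact: measurable_funrpos.
have mfn : measurable_fun setT f^\- by exact: measurable_funrneg.
have -> : f = (fun x => f^\+ x + (-1) * f^\- x).
  by apply/funext => x; rewrite mulN1r -[LHS](congr1 (@^~ x) (funrposBneg f)).
apply: Lp_shift_continuousD => //; first exact: measurable_funM.
  apply: Lp_shift_continuous_ge0 => //.
  apply: le_lt_trans Nf; apply: le_Lnorm => // x.
  by rewrite ger0_norm// /funrpos ge_max ler_norm normr_ge0.
apply: Lp_shift_continuousZ => //; apply: Lp_shift_continuous_ge0 => //.
apply: le_lt_trans Nf; apply: le_Lnorm => // x.
by rewrite ger0_norm// /funrneg ge_max -normrN ler_norm normr_ge0.
Qed.

End Lp_translation.

(** * Complex-valued functions *)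

Section complex_Lp.
Context (R : realType) (d : nat) (p : R).
Hypothesis p1 : 1 <= p.
Let p0 : 0 < p. Proof. exact: lt_le_trans p1. Qed.
Local Notation C := (complex R).
Local Notation N f := (Lnorm (lebesgue_rV R d) p%:E (fun x => (f x)%:E)).
Implicit Types f g h : 'rV[R]_d -> C.

Lemma normc_ge_absRe (z : C) : `|complex.Re z| <= Normc.normc z.
Proof. by case: z => a b /=; rewrite -sqrtr_sqr ler_wsqrtr// lerDl sqr_ge0. Qed.

Lemma normc_ge_absIm (z : C) : `|complex.Im z| <= Normc.normc z.
Proof. by case: z => a b /=; rewrite -sqrtr_sqr ler_wsqrtr// lerDr sqr_ge0. Qed.

Lemma normc_le_absD (z : C) : Normc.normc z <= `|complex.Re z| + `|complex.Im z|.
Proof.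
case: z => a b /=; rewrite -[leRHS]ger0_norm ?addr_ge0// -sqrtr_sqr ler_wsqrtr//.
by rewrite sqrrD !real_normK ?num_real// lerD2r lerDl mulrn_wge0// mulr_ge0.
Qed.

Lemma normc_ge0 (z : C) : 0 <= Normc.normc z.
Proof. exact: le_trans (normc_ge_absRe z). Qed.

Definition measurable_complex f := measurable_fun setT (fun x => complex.Re (f x)) /\
  measurable_fun setT (fun x => complex.Im (f x)).

Lemma measurable_complexD f g : measurable_complex f -> measurable_complex g ->
  measurable_complex (fun x => f x + g x).
Proof.
move=> [fr fi] [gr gi]; split.
- rewrite (_ : (fun x => _) = (fun x => complex.Re (f x) + complex.Re (g x))).
    exact: measurable_funD.
  by apply/funext => x; case: (f x) (g x) => [? ?] [? ?].
- rewrite (_ : (fun x => _) = (fun x => complex.Im (f x) + complex.Im (g x))).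
    exact: measurable_funD.
  by apply/funext => x; case: (f x) (g x) => [? ?] [? ?].
Qed.

Lemma measurable_complexZ f (c : C) : measurable_complex f ->
  measurable_complex (fun x => c * f x).
Proof.
move=> [fr fi]; split.
- rewrite (_ : (fun x => _) =
    (fun x => complex.Re c * complex.Re (f x) - complex.Im c * complex.Im (f x))).
    by apply: measurable_funB; exact: measurable_funM.
  by apply/funext => x; case: c (f x) => [? ?] [? ?].
- rewrite (_ : (fun x => _) =
    (fun x => complex.Re c * complex.Im (f x) + complex.Im c * complex.Re (f x))).
    by apply: measurable_funD; exact: measurable_funM.
  by apply/funext => x; case: c (f x) => [? ?] [? ?].
Qed.

Lemma measurable_complexB f g : measurable_complex f -> measurable_complex g ->
  measurable_complex (fun x => f x - g x).
Proof.
move=> mf mg; rewrite (_ : (fun x => _) = (fun x => f x + (-1) * g x)).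
  exact: measurable_complexD mf (measurable_complexZ (-1) mg).
by apply/funext => x; rewrite mulN1r.
Qed.

Lemma measurable_complex_sum (I : Type) (s : seq I) (F : I -> 'rV[R]_d -> C) :
  (forall i, measurable_complex (F i)) ->
  measurable_complex (fun x => \sum_(i <- s) F i x).
Proof.
move=> mF; elim: s => [|i s IH].
  by rewrite (_ : (fun x => _) = cst 0) //; apply/funext => x; rewrite big_nil.
rewrite (_ : (fun x => _) = (fun x => F i x + \sum_(i <- s) F i x)).
  exact: measurable_complexD.
by apply/funext => x; rewrite big_cons.
Qed.

Lemma measurable_complex_translate f t : measurable_complex f ->
  measurable_complex (translate t f).
Proof.
move=> [fr fi].
by split; [exact: (measurable_fun_shift t fr)|exact: (measurable_fun_shift t fi)].
Qed.

Lemma measurable_normc f : measurable_complex f ->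
  measurable_fun setT (fun x => Normc.normc (f x)).
Proof.
move=> [fr fi]; rewrite (_ : (fun x => _) =
  (fun x => (complex.Re (f x) ^+ 2 + complex.Im (f x) ^+ 2) `^ 2^-1)).
  apply: (measurableT_comp (measurable_powR _)).
  by apply: measurable_funD; exact: measurable_funX.
apply/funext => x; rewrite powR12_sqrt ?addr_ge0 ?sqr_ge0//.
by case: (f x).
Qed.

Lemma Lp_norm_triangle f g h :
  measurable_complex f -> measurable_complex g -> measurable_complex h ->
  (forall x, f x = g x + h x) -> (Lp_norm p f <= Lp_norm p g + Lp_norm p h)%E.
Proof.
move=> mf mg mh fgh; apply: Lnorm_triangle => //; try exact: measurable_normc.
by move=> x; rewrite fgh !ger0_norm ?normc_ge0// le_normcD.
Qed.

Lemma Lp_normZ f (c : C) : measurable_complex f ->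
  (Lp_norm p (fun x => c * f x)%R = (Normc.normc c)%:E * Lp_norm p f)%E.
Proof.
move=> mf; rewrite /Lp_norm -[in RHS](ger0_norm (normc_ge0 c)) -Lnorm_scale//.
  by apply: eq_Lnorm => x; rewrite Normc.normcM.
exact: measurable_normc.
Qed.

Lemma Lp_norm_sum (I : Type) (s : seq I) (F : I -> 'rV[R]_d -> C) :
  (forall i, measurable_complex (F i)) ->
  (Lp_norm p (fun x => \sum_(i <- s) F i x)%R <= \sum_(i <- s) Lp_norm p (F i))%E.
Proof.
move=> mF; elim: s => [|i s IH].
  rewrite big_nil /Lp_norm (eq_Lnorm _ _ (g := cst 0%E)) => [|x].
    by rewrite Lnorm0// eqe gt_eqF.
  by rewrite big_nil Normc.normc0.
rewrite big_cons; apply: le_trans (leeD2l _ IH).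
apply: Lp_norm_triangle => //; try exact: measurable_complex_sum.
by move=> x; rewrite big_cons.
Qed.

Lemma Lp_norm_translate f t : measurable_complex f ->
  Lp_norm p (translate t f) = Lp_norm p f.
Proof. by move=> mf; apply: (Lnorm_shift p t); exact: measurable_normc. Qed.

Lemma coord_le_enorm (s : 'rV[R]_d) i : `|s 0 i| <= enorm s.
Proof.
rewrite -sqrtr_sqr ler_wsqrtr// (bigD1 i)//= lerDl.
by apply: sumr_ge0 => j _; exact: sqr_ge0.
Qed.

(** The modulus is at most the sum of the absolute values of the real and
    imaginary parts, both of which are functions of L^p. *)
Theorem Lp_norm_translate_continuous f : in_Lp p f -> forall e : R, 0 < e ->
  exists2 delta : R, 0 < delta & forall s, enorm s < delta ->
    (Lp_norm p (fun x => translate s f x - f x)%R < e%:E)%E.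
Proof.
move=> [fr fi Nf] e e0.
have e20 : 0 < e / 2 by rewrite divr_gt0.
have mn : measurable_fun setT (fun x => Normc.normc (f x)) by exact: measurable_normc.
have cr : Lp_shift_continuous p (fun x => complex.Re (f x)).
  apply: Lp_shift_continuous_measurable => //; apply: le_lt_trans Nf.
  by apply: le_Lnorm => // x; rewrite (ger0_norm (normc_ge0 _)) normc_ge_absRe.
have ci : Lp_shift_continuous p (fun x => complex.Im (f x)).
  apply: Lp_shift_continuous_measurable => //; apply: le_lt_trans Nf.
  by apply: le_Lnorm => // x; rewrite (ger0_norm (normc_ge0 _)) normc_ge_absIm.
have /nbhs_ballP[delta /= delta0 ball_small] : \forall s \near (0 : 'rV[R]_d),
    (N (fun x : 'rV[R]_d => complex.Re (f (x + s)) - complex.Re (f x))%R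
      < (e / 2)%:E)%E /\
    (N (fun x : 'rV[R]_d => complex.Im (f (x + s)) - complex.Im (f x))%R
      < (e / 2)%:E)%E.
  by apply: filterI; [exact: cr|exact: ci].
exists delta => // s s_small.
have [|Nr Ni] := ball_small s.
  by split=> // i j; rewrite ord1 -ball_normE /ball_ /= !mxE sub0r normrN
    (le_lt_trans (coord_le_enorm s j)).
have mtr : measurable_complex (translate s f) by exact: measurable_complex_translate.
have md : measurable_complex (fun x => translate s f x - f x).
  exact: measurable_complexB.
have mrd := measurable_funB (measurable_fun_shift s fr) fr.
have mid := measurable_funB (measurable_fun_shift s fi) fi.
rewrite [e]splitr EFinD; apply: le_lt_trans (lteD Nr Ni).
apply: Lnorm_triangle => //; first exact: measurable_normc.
move=> x; rewrite (ger0_norm (normc_ge0 _)); apply: le_trans (normc_le_absD _) _.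
by rewrite /translate; case: (f (x + s)) (f x) => [? ?] [? ?].
Qed.

Lemma normc_le_lp_norm (I : choiceType) (c : {fsfun I -> C with 0}) j :
  j \in finsupp c -> Normc.normc (c j) <= lp_norm p c.
Proof.
move=> jc; rewrite -[leLHS](powRr1 (normc_ge0 _)).
rewrite -[X in _ `^ X <= _](mulfV (lt0r_neq0 p0)) powRrM.
rewrite ge0_ler_powR ?nnegrE ?invr_ge0 ?(ltW p0) ?powR_ge0//.
  by rewrite sumr_ge0// => i _; exact: powR_ge0.
rewrite (big_fsetD1 j)//= lerDl sumr_ge0// => i _; exact: powR_ge0.
Qed.

(** Each coefficient is at most the l^p norm of c, so replacing F by G moves the
    combination by at most the sum of the eps j |c j|, that is by at most
    eta ||c||; Minkowski's inequality transfers both bounds. *)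
Theorem Riesz_basis_perturbation (I : choiceType) (F G : I -> 'rV[R]_d -> C)
    (A B eta : R) (eps : I -> R) :
  (forall j, measurable_complex (F j)) -> (forall j, measurable_complex (G j)) ->
  (forall j, Lp_norm p (fun t => G j t - F j t)%R <= (eps j)%:E)%E ->
  (forall s : seq I, uniq s -> \sum_(j <- s) eps j <= eta) ->
  forall c : {fsfun I -> C with 0},
  ((A * lp_norm p c)%:E <= Lp_norm p (lin_comb F c) <= (B * lp_norm p c)%:E)%E ->
  (((A - eta) * lp_norm p c)%:E <= Lp_norm p (lin_comb G c)
     <= ((B + eta) * lp_norm p c)%:E)%E.
Proof.
move=> mF mG FGeps epseta c /andP[lowF upF].
have mlin (H : I -> 'rV[R]_d -> C) : (forall j, measurable_complex (H j)) ->
    measurable_complex (lin_comb H c).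
  by move=> mH; apply: measurable_complex_sum => j; exact: measurable_complexZ.
have mGF j : measurable_complex (fun t => G j t - F j t) by exact: measurable_complexB.
pose E := lin_comb (fun j t => G j t - F j t) c.
have mE : measurable_complex E by exact: mlin.
have GFE t : lin_comb G c t = lin_comb F c t + E t.
  rewrite /E /lin_comb -big_split/=; apply: eq_bigr => j _.
  by rewrite -mulrDr addrC subrK.
have NE : (Lp_norm p E <= (eta * lp_norm p c)%:E)%E.
  apply: le_trans (Lp_norm_sum _ _) _ => [j|]; first exact: measurable_complexZ.
  apply: (@le_trans _ _ (\sum_(j <- finsupp c) (eps j * lp_norm p c)%:E)%E).
    rewrite big_seq [leRHS]big_seq; apply: lee_sum => j jc.
    rewrite Lp_normZ// muleC EFinM lee_pmul ?lee_fin ?normc_ge0 ?normc_le_lp_norm//.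
    exact: Lnorm_ge0.
  by rewrite sumEFin lee_fin -mulr_suml ler_wpM2r ?powR_ge0// epseta.
apply/andP; split.
- rewrite mulrBl EFinB leeBlDr//; apply: le_trans lowF _.
  apply: le_trans (leeD2l _ NE).
  have -> : Lp_norm p E = Lp_norm p (fun t => (-1) * E t).
    by rewrite Lp_normZ// normcN Normc.normc1 mul1e.
  apply: Lp_norm_triangle; [exact: mlin|exact: mlin|exact: measurable_complexZ|].
  by move=> t; rewrite GFE mulN1r addrK.
- rewrite mulrDl EFinD; apply: le_trans (leeD upF NE).
  by apply: Lp_norm_triangle => //; exact: mlin.
Qed.

End complex_Lp.

(** * Summable weights on a countable index set *)

Lemma sum_half_pow_le1 (R : realType) (s : seq nat) : uniq s ->
  \sum_(i <- s) (2^-1 : R) ^+ i.+1 <= 1.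
Proof.
move=> us.
have geo n : \sum_(0 <= i < n) (2^-1 : R) ^+ i.+1 = 1 - 2^-1 ^+ n.
  elim: n => [|n IH]; first by rewrite big_nil expr0 subrr.
  by rewrite big_nat_recr//= IH exprS; field.
pose n := (\max_(i <- s) i).+1.
have sP : perm_eq s [seq i <- iota 0 n | i \in s].
  apply: uniq_perm => // [|i]; first by rewrite filter_uniq// iota_uniq.
  rewrite mem_filter mem_iota /= add0n; case: (boolP (i \in s)) => //= si.
  by rewrite /n ltnS leq_bigmax_seq.
rewrite (perm_big _ sP) big_filter.
apply: (@le_trans _ _ (\sum_(0 <= i < n) (2^-1 : R) ^+ i.+1)).
  rewrite /index_iota subn0 big_mkcond; apply: ler_sum => i _.
  by case: ifP => // _; rewrite exprn_ge0// invr_ge0.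
by rewrite geo gerBl exprn_ge0// invr_ge0.
Qed.

Lemma summable_weights (R : realType) (I : countType) (eta : R) : 0 < eta ->
  exists2 eps : I -> R, (forall j, 0 < eps j) &
    forall s : seq I, uniq s -> \sum_(j <- s) eps j <= eta.
Proof.
move=> eta0; exists (fun j : I => eta * 2^-1 ^+ (choice.pickle j).+1) => [j|s us].
  by rewrite mulr_gt0// exprn_gt0// invr_gt0.
rewrite -mulr_sumr ler_piMr// ?(ltW eta0)//.
rewrite -(big_map (@choice.pickle I) xpredT (fun i => 2^-1 ^+ i.+1)) sum_half_pow_le1//.
by rewrite map_inj_uniq//; exact: pcan_inj (@choice.pickleK I).
Qed.

(** * Stability of p-Riesz bases of translates *)

Theorem theorem1 (R : realType) (d : nat) (p : R)
    (psi : 'rV[R]_d -> R[i]) (x : 'rV[int]_d -> 'rV[R]_d) :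
  (0 < d)%N -> 1 < p ->
  in_W1p p psi ->
  discrete_family x ->
  Riesz_basis p (fun j => translate (x j) psi) (Vp p psi x) ->
  exists delta : 'rV[int]_d -> R,
    (forall j, 0 < delta j) /\
    forall y : 'rV[int]_d -> 'rV[R]_d,
      (forall j, enorm (x j - y j) < delta j) ->
      Riesz_basis p (fun j => translate (y j) psi) (Vp p psi y).
Proof.
move=> _ p_gt1 [psiLp _] _ [_ [A [B [A0 B0 AB]]]].
have p1 := ltW p_gt1.
have mpsi : measurable_complex psi by case: psiLp.
have A20 : 0 < A / 2 by rewrite divr_gt0.
have [eps eps0 eps_sum] := @summable_weights R 'rV[int]_d (A / 2) A20.
have /choice[delta deltaP] : forall j, exists delta : R, 0 < delta /\
    forall s, enorm s < delta ->
      (Lp_norm p (fun t => translate s psi t - psi t)%R < (eps j)%:E)%E.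
  move=> j.
  have [delta delta0 deltaP] := Lp_norm_translate_continuous p1 psiLp (eps0 j).
  by exists delta.
exists delta; split=> [j|y xy]; first exact: (deltaP j).1.
split=> //; exists (A - A / 2), (B + A / 2); split.
- by rewrite {1}[A]splitr addrK.
- exact: addr_gt0.
move=> c; apply/andP.
have mtr z : measurable_complex (translate z psi).
  exact: measurable_complex_translate.
apply: (@Riesz_basis_perturbation _ _ _ p1 _
  (fun j => translate (x j) psi) _ _ _ _ eps) => //.
  move=> j.
  have mdiff := measurable_complexB (mtr (x j - y j)) mpsi.
  have -> : Lp_norm p (fun t => translate (y j) psi t - translate (x j) psi t) =
      Lp_norm p (fun t => translate (x j - y j) psi t - psi t).
    (* Translating the right-hand side by y j gives the opposite of the
       difference on the left. *)
    rewrite -(Lp_norm_translate p (y j) mdiff) /Lp_norm.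
    apply: eq_Lnorm => t; rewrite -normcN opprB /translate.
    by rewrite -addrA (addrC (y j)) subrK.
  exact: ltW ((deltaP j).2 _ (xy j)).
by apply/andP; exact: AB.
Qed.
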